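(* The octahedral POVM $(\pi_y)_{y=1}^6$ on $\mathbb{C}^2$ is a $3$-design POVM, its informational power is $$W(\pi_y) = \frac16\ln 4,$$ and the supremum defining $W(\pi_y)$ is attained by the anti-octahedral ensemble $(\psi_x)_{x=1}^6$, which satisfies $\psi_x\pi_x = 0$ for every $x$.
   Context: Let $\sigma=(\sigma_1,\sigma_2,\sigma_3)$ be the Pauli matrices, and let $n_1,\dots,n_N$ be the vertices of a regular polyhedron inscribed in the unit sphere of $\mathbb{R}^3$. The associated POVM on $\mathbb{C}^2$ is $\pi_y = \frac1N(\mathbb{1}_2 + n_y\cdot\sigma)$, $y=1,\dots,N$, and the associated anti-ensemble is $\psi_x = \frac{1}{2N}(\mathbb{1}_2 - n_x\cdot\sigma)$, $x=1,\dots,N$. The octahedral POVM and anti-octahedral ensemble correspond to the regular octahedron ($N=6$). A finite POVM $(\pi_y)$ on $\mathbb{C}^d$ (positive semidefinite operators with $\sum_y\pi_y=\mathbb{1}_d$) is a $t$-design POVM if for every integer $1\le k\le t$, $\sum_y \frac{\pi_y^{\otimes k}}{\operatorname{Tr}[\pi_y]^{k-1}} = d\binom{d-1+k}{k}^{-1} P_{\mathrm{sym}}$, where $P_{\mathrm{sym}}$ is the orthogonal projector onto the symmetric subspace of $(\mathbb{C}^d)^{\otimes k}$. An ensemble is a measurable function $x\mapsto\rho_x$ from the reals to positive semidefinite operators of trace at most $1$ with $\int\operatorname{Tr}[\rho_x]\,dx=1$; finite ensembles $(\rho_x)$ with $\sum_x\operatorname{Tr}[\rho_x]=1$ are included (sums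 in place of integrals). With $p_{x,y}=\operatorname{Tr}[\rho_x\pi_y]$ and marginals $p_x,p_y$, the mutual information is $I(\rho_x,\pi_y) := \int\sum_y p_{x,y}\ln\frac{p_{x,y}}{p_xp_y}\,dx$ (with $0\ln0=0$). The informational power is $W(\pi_y) := \sup_{\rho_x} I(\rho_x,\pi_y)$ over all ensembles. *)

(* Defs.v *)
From HB Require Import structures.
From mathcomp Require Import all_boot all_order all_algebra all_fingroup.
From mathcomp Require Import sesquilinear spectral.
From mathcomp Require Import complex mxtens.
From mathcomp Require Import all_classical all_reals all_analysis.

Set Implicit Arguments.
Unset Strict Implicit.
Unset Printing Implicit Defensive.

Import Order.TTheory GRing.Theory Num.Theory.

Local Open Scope complex_scope.
Local Open Scope sesquilinear_scope.
Local Open Scope classical_set_scope.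
Local Open Scope ring_scope.

(* In R[i], 0 <= z says that z is real and nonnegative; in particular a
   positive semidefinite operator is Hermitian. *)
Definition psd (R : realType) (d : nat) (A : 'M[R[i]]_d) : Prop :=
  forall v : 'cV[R[i]]_d, 0 <= (v^t* *m A *m v) 0 0.

Definition is_povm (R : realType) (d N : nat) (pi : 'I_N -> 'M[R[i]]_d) : Prop :=
  (forall y, psd (pi y)) /\ \sum_y pi y = 1%:M.

(* [ntensmx] is the iterated Kronecker product, so the coordinate a < d ^ k of
   (C^d)^{(x) k} is the basis tensor e_{a_0} (x) ... (x) e_{a_(k-1)}, where
   a_0 ... a_(k-1) are the base-d digits of a, most significant first. *)
Definition tensor_digit (d k : nat) (a : 'I_(d ^ k)) (l : 'I_k) : nat :=
  ((a %/ d ^ (k - l.+1)) %% d)%N.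

(* The operator permuting the k tensor factors according to s. *)
Definition factor_perm_mx (R : realType) (d k : nat) (s : 'S_k) :
    'M[R[i]]_(d ^ k) :=
  \matrix_(a, b)
    ([forall l : 'I_k, tensor_digit b l == tensor_digit a (s l)])%:R.

(* Row space of the vectors fixed by all permutations of the tensor factors. *)
Definition sym_space (R : realType) (d k : nat) : 'M[R[i]]_(d ^ k) :=
  (\bigcap_(s : 'S_k) eigenspace (factor_perm_mx R d s) 1)%MS.

(* [proj_ortho] acts on row vectors.  As the symmetric subspace is stable under
   entrywise conjugation, this Hermitian matrix is also the matrix of the
   orthogonal projector acting on column vectors. *)
Definition sym_projector (R : realType) (d k : nat) : 'M[R[i]]_(d ^ k) :=
  proj_ortho (sym_space R d k).

Definition is_design_povm (R : realType) (d N t : nat)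
    (pi : 'I_N -> 'M[R[i]]_d) : Prop :=
  is_povm pi /\
  forall k : nat, (1 <= k <= t)%N ->
    \sum_y (\tr (pi y) ^+ k.-1)^-1 *: ntensmx (pi y) k
    = (d%:R * ('C(d.-1 + k, k))%:R^-1) *: sym_projector R d k.

Definition joint_prob (R : realType) (d : nat) (rho pi : 'M[R[i]]_d) : R :=
  complex.Re (\tr (rho *m pi)).

(* If pxy = 0 the product is 0, whatever value the total [ln] takes at 0. *)
Definition mi_term (R : realType) (pxy px py : R) : R :=
  pxy * ln (pxy / (px * py)).

Definition is_ensemble (R : realType) (d : nat)
    (rho : measurableTypeR R -> 'M[R[i]]_d) : Prop :=
  [/\ forall i j,
        measurable_fun setT (fun x => complex.Re (rho x i j)) /\
        measurable_fun setT (fun x => complex.Im (rho x i j)),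
      forall x, psd (rho x) /\ \tr (rho x) <= 1
    & (\int[lebesgue_measure]_x (complex.Re (\tr (rho x)))%:E = 1%:E)%E].

Definition mutual_info (R : realType) (d N : nat)
    (rho : measurableTypeR R -> 'M[R[i]]_d) (pi : 'I_N -> 'M[R[i]]_d) : \bar R :=
  let p x y := joint_prob (rho x) (pi y) in
  let px x := \sum_y p x y in
  let py y := (\int[lebesgue_measure]_x p x y)%R in
  (\int[lebesgue_measure]_x (\sum_y mi_term (p x y) (px x) (py y))%R%:E)%E.

Definition is_fin_ensemble (R : realType) (d m : nat)
    (rho : 'I_m -> 'M[R[i]]_d) : Prop :=
  (forall x, psd (rho x)) /\ \sum_x \tr (rho x) = 1.

Definition fin_mutual_info (R : realType) (d m N : nat)
    (rho : 'I_m -> 'M[R[i]]_d) (pi : 'I_N -> 'M[R[i]]_d) : R :=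
  let p x y := joint_prob (rho x) (pi y) in
  let px x := \sum_y p x y in
  let py y := \sum_x p x y in
  \sum_x \sum_y mi_term (p x y) (px x) (py y).

Definition informational_power (R : realType) (d N : nat)
    (pi : 'I_N -> 'M[R[i]]_d) : \bar R :=
  ereal_sup
    ([set I | exists2 rho : measurableTypeR R -> 'M[R[i]]_d,
                is_ensemble rho & I = mutual_info rho pi] `|`
     [set I | exists (m : nat) (rho : 'I_m -> 'M[R[i]]_d),
                is_fin_ensemble rho /\ I = (fin_mutual_info rho pi)%:E]).

Definition mx22 (R : realType) (a b c e : R[i]) : 'M[R[i]]_2 :=
  \matrix_(i, j) if i == 0 then (if j == 0 then a else b)
                 else (if j == 0 then c else e).

Definition pauli (R : realType) (k : 'I_3) : 'M[R[i]]_2 :=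
  match val k with
  | 0%N => mx22 0 1 1 0
  | 1%N => mx22 0 (- 'i%C) 'i%C 0
  | _ => mx22 1 0 0 (- 1)
  end.

Definition dot_pauli (R : realType) (v : 'rV[R]_3) : 'M[R[i]]_2 :=
  \sum_k (v 0 k)%:C *: pauli R k.

Definition polyhedral_povm (R : realType) (N : nat) (n : 'I_N -> 'rV[R]_3)
    (y : 'I_N) : 'M[R[i]]_2 :=
  N%:R^-1 *: (1%:M + dot_pauli (n y)).

Definition anti_ensemble (R : realType) (N : nat) (n : 'I_N -> 'rV[R]_3)
    (x : 'I_N) : 'M[R[i]]_2 :=
  (2 * N)%:R^-1 *: (1%:M - dot_pauli (n x)).

Definition in_unit_sphere (R : realType) (v : 'rV[R]_3) : Prop :=
  \sum_i v 0 i ^+ 2 = 1.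

(* n enumerates, without repetition and in some order, the vertices of a regular
   octahedron: the image of {e_1, - e_1, e_2, - e_2, e_3, - e_3} under the
   similarity u |-> c + r *: (u *m Q). *)
Definition regular_octahedron (R : realType) (n : 'I_6 -> 'rV[R]_3) : Prop :=
  exists (c : 'rV[R]_3) (r : R) (Q : 'M[R]_3) (f : 'I_6 -> bool * 'I_3),
    [/\ 0 < r, Q *m Q^T = 1%:M, bijective f
      & forall y, n y = c + r *: ((-1) ^+ (f y).1 *: row (f y).2 Q)].

(* Main.v *)
(* A state with trace tau and Bloch vector m yields outcome y with probability
   (tau + n_y . m) / 6, so the vertices -n, n contribute
   (1 + t) ln (1 + t) + (1 - t) ln (1 - t) <= 2 ln 2 t^2, where t = n . m / tau.
   Over the three axes the t^2 add up to |m|^2 / tau^2 <= 1, which bounds the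
   entropy of the outcome relative to the uniform distribution by ln 4 / 6;
   replacing the true marginal by the uniform one only increases the mutual
   information.  The anti-octahedral ensemble has |m| = tau and all t in
   {-1, 0, 1}, where the inequality is an equality.  For the design property, the
   symmetric projector averages over basis tensors whose digits agree up to a
   permutation, and the matrix entries follow from the second moment of the
   octahedron and the completeness relation of the Pauli matrices. *)

Require Import Defs.
From mathcomp Require Import all_boot all_order all_algebra all_fingroup.
From mathcomp Require Import sesquilinear spectral.
From mathcomp Require Import complex mxtens.
From mathcomp Require Import all_classical all_reals all_analysis.
From mathcomp Require Import ring lra.

Set Implicit Arguments.
Unset Strict Implicit.
Unset Printing Implicit Defensive.

Import Order.TTheory GRing.Theory Num.Theory.
Import numFieldNormedType.Exports measurable_realfun.

Local Open Scope complex_scope.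
Local Open Scope sesquilinear_scope.
Local Open Scope ring_scope.

(** * The symmetric projector *)

(** The [j] least significant digits determine the residue modulo [d ^ j], by induction on [j]; at
    [j = k] the residue is the index itself. *)
Lemma tensor_digit_inj (d k : nat) (a b : 'I_(d ^ k)) :
  (forall l : 'I_k, tensor_digit a l = tensor_digit b l) -> a = b.
Proof.
move=> ab; have H j : (j <= k -> a %% d ^ j = b %% d ^ j)%N.
  elim: j => [|j IH] jk; first by rewrite expn0 !modn1.
  have dE (c : nat) : (c %% d ^ j.+1 = (c %/ d ^ j) %% d * d ^ j + c %% d ^ j)%N.
    by rewrite expnS modn_divl {1}(divn_eq (c %% _) (d ^ j)) modn_dvdm
      ?dvdn_mull // mulnC.
  have lk : (k - j.+1 < k)%N by rewrite ltn_subrL (leq_ltn_trans _ jk).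
  have := ab (Ordinal lk); rewrite /tensor_digit /= subnSK // subKn; last exact: ltnW.
  by rewrite !dE => ->; rewrite IH // ltnW.
by apply/val_inj; have := H k (leqnn k); rewrite !modn_small.
Qed.

Lemma tensor_digit_lt (d k : nat) (a : 'I_(d ^ k)) (l : 'I_k) :
  (tensor_digit a l < d)%N.
Proof.
rewrite ltn_mod; case: d a => // -[a /=].
by rewrite exp0n // (leq_ltn_trans _ (ltn_ord l)).
Qed.

(** Reading off digits is an injection between two sets of [d ^ k] elements, hence a bijection. *)
Lemma tensor_digit_surj (d k : nat) (g : 'I_k -> 'I_d) :
  exists a : 'I_(d ^ k), forall l, tensor_digit a l = g l.
Proof.
pose h (a : 'I_(d ^ k)) := [ffun l : 'I_k => Ordinal (tensor_digit_lt a l)].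
have h_inj : injective h.
  move=> a b /ffunP ab; apply: tensor_digit_inj => l.
  by have /(congr1 val) := ab l; rewrite !ffunE.
have [|h' h'K hK] := inj_card_bij h_inj; first by rewrite card_ffun !card_ord.
exists (h' [ffun l => g l]) => l.
by have /ffunP/(_ l)/(congr1 val) := hK [ffun l => g l]; rewrite !ffunE.
Qed.

Definition digit_word (d k : nat) (a : 'I_(d ^ k)) : k.-tuple nat :=
  [tuple tensor_digit a l | l < k].

(** This is the orbit relation of the symmetric group on basis tensors. The form with [perm_eq] can
    be evaluated. *)
Definition same_type (d k : nat) : rel 'I_(d ^ k) :=
  fun a b => perm_eq (digit_word a) (digit_word b).

Lemma same_typeP (d k : nat) (a b : 'I_(d ^ k)) :
  reflect (exists s : 'S_k, forall l, tensor_digit a l = tensor_digit b (s l))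
    (same_type a b).
Proof.
apply: (iffP tuple_permP) => -[s ab]; exists s.
  move=> l; have /val_inj/(congr1 (fun t => tnth t l)) := ab.
  by rewrite !tnth_mktuple.
congr (tval _); apply: eq_from_tnth => l.
by rewrite !tnth_mktuple.
Qed.

Lemma same_type_refl (d k : nat) : reflexive (@same_type d k).
Proof. by move=> a; apply: perm_refl. Qed.

Lemma same_type_sym (d k : nat) : symmetric (@same_type d k).
Proof. by move=> a b; apply: perm_sym. Qed.

Lemma same_type_left (d k : nat) : left_transitive (@same_type d k).
Proof. by move=> a b ab c; have /permPl := ab; apply. Qed.

Definition type_card (d k : nat) (a : 'I_(d ^ k)) : nat := #|same_type a|.

Lemma type_card_gt0 (d k : nat) (a : 'I_(d ^ k)) : (0 < type_card a)%N.
Proof. by apply/card_gt0P; exists a; exact: same_type_refl. Qed.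

Lemma type_card_eq (d k : nat) (a b : 'I_(d ^ k)) :
  same_type a b -> type_card a = type_card b.
Proof. by move=> ab; apply: eq_card => c; exact: same_type_left. Qed.

(** Averaging coordinates over each orbit: the explicit form of the symmetric projector. *)
Definition type_average_mx (R : realType) (d k : nat) : 'M[R[i]]_(d ^ k) :=
  \matrix_(a, b) ((same_type a b)%:R / (type_card a)%:R).

Section SymProjector.
Variables (R : realType) (d k : nat).
Local Notation P := (type_average_mx R d k).

Lemma sym_spaceP m (v : 'M[R[i]]_(m, d ^ k)) :
  reflect (forall s : 'S_k, v *m factor_perm_mx R d s = v)
    (v <= sym_space R d k)%MS.
Proof.
apply: (iffP sub_bigcapmxP) => [H s|H s _].
  by have /eigenspaceP := H s isT; rewrite scale1r.
by apply/eigenspaceP; rewrite scale1r.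
Qed.

(** Digits determine an index, so column [b] of the permutation matrix has a single [1], in row
    [a]. *)
Lemma mul_factor_perm_mx m (v : 'M[R[i]]_(m, d ^ k)) (s : 'S_k) c a b :
  (forall l, tensor_digit b l = tensor_digit a (s l)) ->
  (v *m factor_perm_mx R d s) c b = v c a.
Proof.
move=> ab; rewrite mxE (bigD1 a) //= mxE.
have -> : [forall l, tensor_digit b l == tensor_digit a (s l)].
  by apply/forallP => l; apply/eqP.
rewrite mulr1 big1 ?addr0 // => a' /eqP aa'; rewrite mxE.
case: forallP => [H|]; last by rewrite mulr0.
case: aa'; apply: tensor_digit_inj => l.
by rewrite -(permKV s l) -ab; apply/esym/eqP.
Qed.

Lemma type_average_mx_sub : (P <= sym_space R d k)%MS.
Proof.
apply/sym_spaceP => s; apply/matrixP => c b.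
have [a ab] := tensor_digit_surj (fun l => Ordinal (tensor_digit_lt b (s^-1 l))%g).
have {}ab l : tensor_digit b l = tensor_digit a (s l) by rewrite ab /= permK.
rewrite (mul_factor_perm_mx _ _ ab) !mxE.
suff -> : same_type c a = same_type c b by [].
rewrite !(same_type_sym c); apply: same_type_left.
by rewrite same_type_sym; apply/same_typeP; exists s.
Qed.

(** The coordinates of an invariant vector are constant on each orbit, so averaging over orbits
    returns it. *)
Lemma mul_type_average_mx m (v : 'M[R[i]]_(m, d ^ k)) :
  (v <= sym_space R d k)%MS -> v *m P = v.
Proof.
move=> /sym_spaceP vF; apply/matrixP => c b; rewrite mxE.
have vE a : same_type b a -> v c a = v c b.
  by move=> /same_typeP[s ab]; rewrite -[in RHS](vF s) (mul_factor_perm_mx _ _ ab).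
rewrite (eq_bigr (fun a => (same_type b a)%:R * (v c b / (type_card b)%:R))).
  rewrite -mulr_suml -natr_sum (_ : \sum_a _ = type_card b)%N; last first.
    rewrite /type_card -sum1_card [RHS]big_mkcond /=; apply: eq_bigr => a _.
    by rewrite unfold_in /same_type; case: perm_eq.
  by rewrite mulrCA divff ?mulr1 // pnatr_eq0 -lt0n type_card_gt0.
move=> a _; rewrite mxE same_type_sym; case ba : (same_type b a).
  by rewrite !mul1r vE // (type_card_eq ba).
by rewrite !mul0r mulr0.
Qed.

Lemma type_average_mx_herm : P^t* = P.
Proof.
apply/matrixP => a b; rewrite !mxE rmorphM fmorphV /= !conjC_nat same_type_sym.
case ab : (same_type a b); last by rewrite !mul0r.
by rewrite (type_card_eq ab).
Qed.

(** Split [1] as [(1 - P) + P]. The projector fixes the rows of [P], which are symmetric, and kills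
    those of [1 - P]: as [P] is Hermitian and fixes the symmetric space, these are orthogonal to
    that space. *)
Lemma sym_projectorE : sym_projector R d k = P.
Proof.
rewrite /sym_projector -[LHS]mul1mx -(subrK P 1%:M) mulmxDl.
rewrite (proj_ortho_id type_average_mx_sub) proj_ortho_0 ?add0r //.
apply/orthomx1P.
rewrite -[sym_space R d k in LHS](mul_type_average_mx (submx_refl _)).
rewrite trmx_mul map_mxM type_average_mx_herm mulmxA mulmxBl mul1mx.
by rewrite (mul_type_average_mx type_average_mx_sub) subrr mul0mx.
Qed.

End SymProjector.

(** * Entropy of a pair of opposite outcomes *)

Lemma is_derive_ge0_le (R : realType) (f df : R -> R) (a b : R) :
  a <= b -> (forall x, a <= x <= b -> is_derive x 1 f (df x)) ->
  (forall x, a <= x <= b -> 0 <= df x) -> f a <= f b.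
Proof.
move=> ab fdf df0.
have [||c cab E] := @MVT_segment R f df a b ab.
- by move=> x; rewrite in_itv /= => /andP[ax xb]; apply: fdf; rewrite !ltW.
- apply: derivable_within_continuous => x; rewrite in_itv /= => xab.
  by have [] := fdf x xab.
- by rewrite -subr_ge0 E mulr_ge0 ?subr_ge0 // df0 //; move: cab; rewrite in_itv.
Qed.

Section PairEntropy.
Variable R : realType.
Implicit Types x t s : R.

(** Twice the entropy of the distribution [((1 + t) / 2, (1 - t) / 2)] relative to the uniform
    one. *)
Definition pair_entropy t : R := (1 + t) * ln (1 + t) + (1 - t) * ln (1 - t).

Lemma is_derive_ln1D x : -1 < x -> is_derive x 1 (fun t => ln (1 + t)) (1 + x)^-1.
Proof.
move=> x1; have x0 : 0 < 1 + x by lra.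
have D := is_derive1_ln x0.
by apply: is_derive_eq; rewrite add0r mulr1.
Qed.

Lemma is_derive_ln1B x : x < 1 -> is_derive x 1 (fun t => ln (1 - t)) (- (1 - x)^-1).
Proof.
move=> x1; have x0 : 0 < 1 - x by lra.
have D := is_derive1_ln x0.
by apply: is_derive_eq; rewrite add0r mul1r mulrN1.
Qed.

Lemma is_derive_inv1D x : -1 < x ->
  is_derive x 1 (fun t : R => (1 + t)^-1) (- (1 + x) ^- 2).
Proof.
move=> x1; have x0 : 1 + x != 0 by lra.
have D : is_derive x 1 (fun t : R => 1 + t) 1 by apply: is_derive_eq; ring.
by have := is_deriveV x0 D; rewrite /GRing.scale /= mulr1.
Qed.

Lemma is_derive_inv1B x : x < 1 ->
  is_derive x 1 (fun t : R => (1 - t)^-1) ((1 - x) ^- 2).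
Proof.
move=> x1; have x0 : 1 - x != 0 by lra.
have D : is_derive x 1 (fun t : R => 1 - t) (- 1).
  by apply: is_derive_eq; ring.
by have := @is_deriveV _ (fun t : R => 1 - t) x _ _ x0 D; rewrite /GRing.scale /= mulrN1 opprK.
Qed.

(** The expression vanishes at [0] and its derivative is a square. It is itself the derivative of
    the expression in [ln_weighted_le]. *)
Lemma ln_ratio_le t : 0 <= t < 1 ->
  0 <= ln (1 - t) - ln (1 + t) + (1 - t)^-1 - (1 + t)^-1.
Proof.
move=> /andP[t0 t1].
pose q x : R := ln (1 - x) - ln (1 + x) + (1 - x)^-1 - (1 + x)^-1.
have -> : 0 = q 0 by rewrite /q !(subr0, addr0) subrr add0r subrr.
pose dq x : R := ((1 - x)^-1 - (1 + x)^-1) ^+ 2.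
apply: (@is_derive_ge0_le _ q dq) => // x /andP[x0 xt]; last exact: sqr_ge0.
have x1 : x < 1 by lra.
have x2 : -1 < x by lra.
have D1 := is_derive_ln1D x2.
have D2 := is_derive_ln1B x1.
have D3 := is_derive_inv1D x2.
have D4 := is_derive_inv1B x1.
have x3 : 1 - x != 0 by lra.
have x4 : 1 + x != 0 by lra.
by apply: is_derive_eq; rewrite /dq; field; rewrite x3 x4.
Qed.

Lemma ln_weighted_le t : 0 <= t < 1 ->
  0 <= - (2 + t) * ln (1 + t) - (2 - t) * ln (1 - t).
Proof.
move=> /andP[t0 t1].
pose q x : R := - (2 + x) * ln (1 + x) - (2 - x) * ln (1 - x).
have -> : 0 = q 0 by rewrite /q !(subr0, addr0) ln1 !mulr0 subrr.
pose dq x : R := ln (1 - x) - ln (1 + x) + (1 - x)^-1 - (1 + x)^-1.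
apply: (@is_derive_ge0_le _ q dq) => // x /andP[x0 xt]; last first.
  by apply: ln_ratio_le; lra.
have x1 : x < 1 by lra.
have x2 : -1 < x by lra.
have D1 := is_derive_ln1D x2.
have D2 := is_derive_ln1B x1.
have x3 : 1 - x != 0 by lra.
have x4 : 1 + x != 0 by lra.
by apply: is_derive_eq; rewrite /dq /GRing.scale /=; field; rewrite x3 x4.
Qed.

(** The derivative of [pair_entropy x / x ^ 2] is the expression of [ln_weighted_le] divided by
    [x ^ 3], so this ratio is nondecreasing on []0, 1[]. *)
Lemma pair_entropy_ratio_le s t : 0 < t -> t <= s -> s < 1 ->
  pair_entropy t * t ^- 2 <= pair_entropy s * s ^- 2.
Proof.
move=> t0 ts s1.
pose q x : R := pair_entropy x * x ^- 2.
pose dq x : R := (- (2 + x) * ln (1 + x) - (2 - x) * ln (1 - x)) * x ^- 3.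
apply: (@is_derive_ge0_le _ q dq) => // x /andP[x0 xt]; last first.
  by rewrite mulr_ge0 // ?invr_ge0 ?exprn_ge0 //; [apply: ln_weighted_le|]; lra.
have x1 : x < 1 by lra.
have x2 : -1 < x by lra.
have D1 := is_derive_ln1D x2.
have D2 := is_derive_ln1B x1.
have x3 : 1 - x != 0 by lra.
have x4 : 1 + x != 0 by lra.
have x5 : x != 0 by lra.
have x6 : x ^+ 2 != 0 by rewrite expf_neq0.
have D5 : is_derive x 1 (fun y : R => y ^+ 2) (2 * x).
  by apply: is_derive_eq; rewrite /GRing.scale /=; ring.
have D6 := @is_deriveV _ (fun y : R => y ^+ 2) x _ _ x6 D5.
apply: is_derive_eq; rewrite /pair_entropy /dq /GRing.scale /=; field.
by rewrite x3 x4 x5.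
Qed.

Lemma pair_entropyN t : pair_entropy (- t) = pair_entropy t.
Proof. by rewrite /pair_entropy opprK addrC. Qed.

(** By evenness take [0 <= t]; the endpoints [0] and [1] are computed directly. In between, the
    ratio to [t ^ 2] increases towards its value [2 * ln 2] at [1]. *)
Lemma pair_entropy_le t : -1 <= t <= 1 -> pair_entropy t <= 2 * ln 2 * t ^+ 2.
Proof.
wlog t0 : t / 0 <= t.
  move=> H; have [/H//|t0 /andP[tl tr]] := leP 0 t.
  by rewrite -pair_entropyN -sqrrN; apply: H; lra.
move=> /andP[_]; rewrite le_eqVlt => /predU1P[->|t1].
  by rewrite /pair_entropy subrr mul0r addr0 expr1n mulr1.
move: t0; rewrite le_eqVlt => /predU1P[<-|t0].
  by rewrite /pair_entropy subr0 addr0 ln1 !mulr0 addr0 expr0n mulr0.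
have ln2 : 0 <= ln (2 : R) by apply: ln_ge0; lra.
have key s : t <= s -> s < 1 -> pair_entropy t * s ^+ 2 <= 2 * ln 2 * t ^+ 2.
  move=> ts s1; have s0 : 0 < s by lra.
  have := pair_entropy_ratio_le t0 ts s1.
  rewrite ler_pdivrMr ?exprn_gt0 // mulrAC ler_pdivlMr ?exprn_gt0 // => /le_trans; apply.
  rewrite ler_wpM2r ?sqr_ge0 // /pair_entropy.
  have : ln (1 + s) <= ln 2 by rewrite ler_ln ?posrE; lra.
  have : ln (1 - s) <= 0 by apply: ln_le0; lra.
  by nra.
(* Letting [s] tend to [1] in [key] would conclude. Instead, a failure makes [c = C / G < 1] bound
   every [s ^ 2] in [key], which the choice [s = (1 + c) / 2] contradicts. *)
rewrite leNgt; apply/negP => gt.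
set G := pair_entropy t in key gt; set C := 2 * ln 2 * t ^+ 2 in key gt.
have C0 : 0 <= C by rewrite /C mulr_ge0 ?sqr_ge0 ?mulr_ge0 ?ler0n.
have G0 : 0 < G by exact: le_lt_trans gt.
(* c <= ((1 + c) / 2)^2, strictly unless c = 1 *)
pose c := C / G.
have c1 : c < 1 by rewrite ltr_pdivrMr // mul1r.
have ct : t ^+ 2 <= c by rewrite ler_pdivlMr // mulrC key.
have : ((1 + c) / 2) ^+ 2 <= c.
  by rewrite ler_pdivlMr // mulrC; apply: key; nra.
by nra.
Qed.

End PairEntropy.

(** * Bounding the mutual information *)

(** The integral of a nonnegative function is a supremum over the simple functions below it, hence
    monotone; positive and negative parts give the general case. *)
Lemma le_integral_pointwise d (T : measurableType d) (R : realType)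
    (mu : {measure set T -> \bar R}) (f g : T -> \bar R) :
  (forall x, f x <= g x)%E -> (\int[mu]_x f x <= \int[mu]_x g x)%E.
Proof.
move=> fg; have nn (u v : T -> \bar R) : (forall x, 0 <= u x)%E ->
    (forall x, u x <= v x)%E -> (\int[mu]_x u x <= \int[mu]_x v x)%E.
  move=> u0 uv; rewrite !ge0_integralTE//; last by move=> x; exact: le_trans (uv x).
  apply: le_ereal_sup => _ [h hu <-]; exists h => // x.
  exact: le_trans (uv x).
rewrite integralE [leRHS]integralE leeB//; apply: nn => // x.
  by apply: (@funepos_le _ _ setT) => //; rewrite inE.
by apply: (@funeneg_le _ _ setT) => //; rewrite inE.
Qed.

Lemma ln_le_subr1 (R : realType) (z : R) : 0 < z -> ln z <= z - 1.
Proof.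
by move=> z0; rewrite -[z in ln z](subrK 1) addrC; apply: le_ln1Dx; lra.
Qed.

Lemma Re_sum (R : realType) I (r : seq I) (P : pred I) (F : I -> R[i]) :
  complex.Re (\sum_(i <- r | P i) F i) = \sum_(i <- r | P i) complex.Re (F i).
Proof. by apply: (big_morph (@complex.Re R)) => // -[a b] [c e]. Qed.

Section MutualInformation.
Variable R : realType.
Implicit Types p tau P c C : R.

(** For a fixed marginal [P] this is linear in [tau] and [p], so its total over [x] follows from the
    totals of [tau] and [p]. *)
Definition marginal_weight c tau P p : R :=
  (if P == 0 then c^-1 else 0) * tau + (if P == 0 then 0 else (c * P)^-1) * p.

(* The joint bound p ln (p / (tau P)) <= p ln (c p / tau) - p + p / (c P) is
   ln z <= z - 1 at z = 1 / (c P); at P = 0 its left-hand side is 0 and tau / c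
   replaces the last term. *)
Lemma mi_term_le c p tau P : 0 < c -> 0 <= p -> p <= tau -> 0 <= P ->
  mi_term p tau P <= p * ln (c * p / tau) - p + marginal_weight c tau P p.
Proof.
move=> c0; rewrite le_eqVlt => /predU1P[<- tau0 P0|p0 ptau].
  rewrite /mi_term /marginal_weight !mul0r subr0 add0r mulr0 addr0 mulr_ge0 //.
  by case: ifP => // _; rewrite invr_ge0 ltW.
have tau0 : 0 < tau by exact: lt_le_trans ptau.
rewrite /mi_term /marginal_weight le_eqVlt => /predU1P[<-|P0].
  (* In an integral, [p > 0] with [P = 0] may occur on a null set. Since [p / 0 = 0] and [ln 0 = 0],
     the left-hand side is [0]; the right-hand side is nonnegative by [ln z <= z - 1] at
     [z = tau / (c * p)]. *)
  rewrite eqxx mulr0 invr0 mulr0 ln0 // mulr0 mul0r addr0.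
  have z0 : 0 < tau / (c * p) by rewrite divr_gt0 ?mulr_gt0.
  have := ln_le_subr1 z0; rewrite -[tau / _]invrK lnV ?posrE ?invr_gt0 // invf_div => H.
  have pc : p * (tau / (c * p)) = c^-1 * tau.
    by field; rewrite !gt_eqF.
  have : p * - ln (c * p / tau) <= p * ((c * p / tau)^-1 - 1) by rewrite ler_wpM2l // ltW.
  by rewrite invf_div mulrBr pc; lra.
rewrite gt_eqF // mul0r add0r.
have z0 : 0 < (c * P)^-1 by rewrite invr_gt0 mulr_gt0.
have -> : p / (tau * P) = (c * p / tau) * (c * P)^-1.
  by field; rewrite !gt_eqF.
rewrite lnM ?posrE ?divr_gt0 ?mulr_gt0 //.
have H := ln_le_subr1 z0; rewrite mulrDr -addrA lerD2l.
have : p * ln (c * P)^-1 <= p * ((c * P)^-1 - 1) by rewrite ler_wpM2l // ltW.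
by rewrite mulrBr mulr1; lra.
Qed.

(** The terms [- p] of [mi_term_le] add up to [- tau]. Over a whole ensemble this loss of [1] is
    compensated by the weights, whose total is [1] when [c = N]. *)
Lemma sum_mi_term_le c C (N : nat) (p P : 'I_N -> R) :
  let tau := \sum_y p y in
  0 < c -> (forall y, 0 <= p y) -> (forall y, 0 <= P y) ->
  \sum_y p y * ln (c * p y / tau) <= C * tau ->
  \sum_y mi_term (p y) tau (P y) <=
    (C - 1) * tau + \sum_y marginal_weight c tau (P y) (p y).
Proof.
move=> tau c0 p0 P0 pC.
apply: (@le_trans _ _ (\sum_y (p y * ln (c * p y / tau) - p y
                         + marginal_weight c tau (P y) (p y)))).
  apply: ler_sum => y _; apply: mi_term_le => //.
  by rewrite /tau (bigD1 y) //= lerDl sumr_ge0.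
by rewrite big_split /= sumrB -/tau mulrBl mul1r lerD2r lerB.
Qed.

Variables (d N : nat) (pi : 'I_N -> 'M[R[i]]_d) (C : R).
Hypothesis pi_sum : \sum_y pi y = 1%:M.
Hypothesis pi_ge0 : forall A y, psd A -> 0 <= joint_prob A (pi y).
(** Per unit of trace, [C] bounds the entropy of the outcome distribution relative to the uniform
    one. *)
Hypothesis pi_le : forall A, psd A ->
  \sum_y joint_prob A (pi y) *
    ln (N%:R * joint_prob A (pi y) / complex.Re (\tr A)) <= C * complex.Re (\tr A).

Lemma sum_joint_prob (A : 'M[R[i]]_d) :
  \sum_y joint_prob A (pi y) = complex.Re (\tr A).
Proof.
rewrite /joint_prob -[in RHS](mulmx1 A) -pi_sum mulmx_sumr.
by rewrite (raddf_sum (@mxtrace _ d)) Re_sum.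
Qed.

(** Over an ensemble, [tau] has total [1] and [p] has total [P], so by linearity this is the total
    weight of one outcome. *)
Lemma marginal_weight_mean P :
  (0 < N)%N -> marginal_weight N%:R 1 P P = N%:R^-1.
Proof.
move=> N0; rewrite /marginal_weight; case: eqP => [->|/eqP p0].
  by rewrite mul0r addr0 mulr1.
by rewrite mul0r add0r; field; rewrite p0 pnatr_eq0 -lt0n N0.
Qed.

Lemma fin_mutual_info_le (m : nat) (rho : 'I_m -> 'M[R[i]]_d) :
  (0 < N)%N -> is_fin_ensemble rho -> fin_mutual_info rho pi <= C.
Proof.
move=> N0 [rho0 rho1].
pose tau x := complex.Re (\tr (rho x)).
have tau1 : \sum_x tau x = 1 by rewrite -Re_sum rho1.
pose P y := \sum_x joint_prob (rho x) (pi y).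
have P0 y : 0 <= P y by apply: sumr_ge0 => x _; exact: pi_ge0.
apply: (@le_trans _ _ (\sum_x ((C - 1) * tau x
    + \sum_y marginal_weight N%:R (tau x) (P y) (joint_prob (rho x) (pi y))))).
  apply: ler_sum => x _; rewrite /tau -sum_joint_prob.
  apply: sum_mi_term_le => //; first by rewrite ltr0n.
    by move=> y; exact: pi_ge0.
  by rewrite sum_joint_prob; exact: pi_le.
rewrite big_split /= -mulr_sumr tau1 mulr1 exchange_big /=.
under eq_bigr => y _ do
  rewrite big_split /= -!mulr_sumr tau1 -/(P y) -/(marginal_weight _ _ _ _)
    marginal_weight_mean //.
rewrite sumr_const card_ord -[_ *+ N]mulr_natr mulVf ?subrK //.
by rewrite pnatr_eq0 -lt0n.
Qed.

Lemma measurable_joint_prob (rho : measurableTypeR R -> 'M[R[i]]_d) y :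
  is_ensemble rho ->
  measurable_fun setT (fun x => joint_prob (rho x) (pi y)).
Proof.
move=> [mrho _ _].
have -> : (fun x => joint_prob (rho x) (pi y)) = (fun x => \sum_i \sum_j
    (complex.Re (rho x i j) * complex.Re (pi y j i)
     - complex.Im (rho x i j) * complex.Im (pi y j i))).
  apply/funext => x; rewrite /joint_prob /mxtrace Re_sum.
  apply: eq_bigr => i _; rewrite mxE Re_sum; apply: eq_bigr => j _.
  by case: (rho x i j) => a b; case: (pi y j i).
apply: measurable_sum => i; apply: measurable_sum => j.
have [mRe mIm] := mrho i j.
by apply: measurable_funB; apply: measurable_funM => //; exact: measurable_cst.
Qed.

Lemma mutual_info_le (rho : measurableTypeR R -> 'M[R[i]]_d) :
  (0 < N)%N -> is_ensemble rho -> (mutual_info rho pi <= C%:E)%E.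
Proof.
move=> N0 erho; have [_ rho0 rho1] := erho.
pose mu : {measure set (measurableTypeR R) -> \bar R} := lebesgue_measure.
pose tau x := complex.Re (\tr (rho x)).
pose p x y := joint_prob (rho x) (pi y).
have p0 x y : 0 <= p x y by apply: pi_ge0; have [] := rho0 x.
have tauE x : tau x = \sum_y p x y by rewrite /tau -sum_joint_prob.
have tau0 x : 0 <= tau x by rewrite tauE; apply: sumr_ge0.
have mtau : measurable_fun setT tau.
  rewrite (_ : tau = fun x => \sum_y p x y); last exact/funext.
  by apply: measurable_sum => y; exact: measurable_joint_prob.
have itau : mu.-integrable setT (EFin \o tau).
  apply/integrableP; split; first exact/measurable_EFinP.
  rewrite (eq_integral (fun x => (tau x)%:E)) ?rho1 ?ltry // => x _ /=.
  by rewrite ger0_norm.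
have ip y : mu.-integrable setT (fun x => (p x y)%:E).
  (* Domination by the trace: [0 <= p x y <= tau x]. *)
  apply: le_integrable itau => //.
    by apply/measurable_EFinP; exact: measurable_joint_prob.
  move=> x _ /=; rewrite lee_fin !ger0_norm // tauE (bigD1 y) //= lerDl.
  exact: sumr_ge0.
pose P y := (\int[mu]_x p x y)%R.
have P0 y : 0 <= P y by apply: Rintegral_ge0.
have PE y : (\int[mu]_x (p x y)%:E)%E = (P y)%:E.
  by rewrite /P /Rintegral fineK //; exact: integrable_fin_num.
pose w x y := marginal_weight N%:R (tau x) (P y) (p x y).
have iZ c f : mu.-integrable setT (EFin \o f) ->
    mu.-integrable setT (fun x => (c * f x)%:E).
  by move=> /(integrableZl measurableT c).
have iw y : mu.-integrable setT (fun x => (w x y)%:E).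
  by apply: (integrableD measurableT (iZ _ _ itau) (iZ _ _ (ip y))).
have wE y : (\int[mu]_x (w x y)%:E)%E = (N%:R^-1)%:E.
  rewrite [LHS](integralD measurableT (iZ _ _ itau) (iZ _ _ (ip y))).
  rewrite [X in (X + _)%E](integralZl measurableT itau).
  rewrite [X in (_ + X)%E](integralZl measurableT (ip y)) PE rho1 -EFinD.
  by congr EFin; exact: marginal_weight_mean.
(* The integrand of the mutual information is only compared pointwise; linearity of the integral is
   applied to the integrable bound. *)
apply: (@le_trans _ _ (\int[mu]_x ((C - 1) * tau x + \sum_y w x y)%:E)%E).
  apply: le_integral_pointwise => x; rewrite lee_fin.
  rewrite /w tauE; apply: sum_mi_term_le => //; first by rewrite ltr0n.
    by move=> y; exact: p0.
  by have [/pi_le + _] := rho0 x; rewrite -sum_joint_prob.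
under eq_integral do rewrite EFinD -sumEFin.
rewrite (integralD measurableT (iZ _ _ itau)); last exact: integrable_sum.
rewrite (integralZl measurableT itau) rho1 integral_sum //.
under eq_bigr do rewrite wE.
rewrite sumEFin sumr_const card_ord -[_ *+ N]mulr_natr mulVf ?pnatr_eq0 -?lt0n //.
by rewrite mule1 -EFinD subrK.
Qed.

End MutualInformation.

(** * Pauli matrices and the octahedron *)

Definition dotv (R : pzRingType) (u v : 'rV[R]_3) : R := \sum_k u 0 k * v 0 k.

Lemma dotvC (S : comPzRingType) (u v : 'rV[S]_3) : dotv u v = dotv v u.
Proof. by apply: eq_bigr => k _; rewrite mulrC. Qed.

Lemma dotvNl (S : pzRingType) (u v : 'rV[S]_3) : dotv (- u) v = - dotv u v.
Proof. by rewrite /dotv -sumrN; apply: eq_bigr => k _; rewrite mxE mulNr. Qed.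

(** Parseval's identity for the orthonormal rows of [Q], from [Q^T *m Q = 1]. The form is bilinear
    over any commutative ring, to serve both real and complex vectors. *)
Lemma sum_dotv_rows (S : comNzRingType) (Q : 'M[S]_3) (u v : 'rV[S]_3) :
  Q *m Q^T = 1%:M ->
  \sum_j dotv (row j Q) u * dotv (row j Q) v = dotv u v.
Proof.
move=> /mulmx1C/matrixP QtQ.
transitivity (\sum_k \sum_l (u 0 k * v 0 l) * (k == l)%:R).
  under eq_bigr do rewrite /dotv big_distrlr /=.
  rewrite exchange_big; apply: eq_bigr => k _.
  rewrite exchange_big; apply: eq_bigr => l _.
  have := QtQ k l; rewrite !mxE => <-; rewrite mulr_sumr.
  by apply: eq_bigr => j _; rewrite !mxE; ring.
apply: eq_bigr => k _; rewrite (bigD1 k) //= eqxx mulr1 big1 ?addr0 // => l.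
by rewrite eq_sym => /negPf ->; rewrite mulr0.
Qed.

Section Octahedron.
Variable R : realType.
Implicit Types u v : 'rV[R]_3.

Lemma dotvE u v : dotv u v = u 0 0 * v 0 0 + u 0 1 * v 0 1 + u 0 2%:R * v 0 2%:R.
Proof.
rewrite /dotv !big_ord_recl big_ord0 addr0 addrA.
by congr (_ * _ + _ * _ + _ * _); congr (_ _ _); apply: val_inj.
Qed.

Lemma dot_pauliE v : dot_pauli v =
  mx22 (v 0 2%:R)%:C (v 0 0 -i* v 0 1) (v 0 0 +i* v 0 1) (- v 0 2%:R)%:C.
Proof.
rewrite /dot_pauli !big_ord_recl big_ord0 addr0.
have -> : lift ord0 ord0 = 1 :> 'I_3 by apply: val_inj.
have -> : lift ord0 (lift ord0 ord0) = 2%:R :> 'I_3 by apply: val_inj.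
apply/matrixP => i j; rewrite /pauli !mxE /=.
by case: ifP => _; case: ifP => _; apply/eqP; rewrite eq_complex /=;
  apply/andP; split; apply/eqP; ring.
Qed.

Lemma mx22P (a b c e a' b' c' e' : R[i]) :
  a = a' -> b = b' -> c = c' -> e = e' -> mx22 a b c e = mx22 a' b' c' e'.
Proof. by move=> -> -> -> ->. Qed.

Lemma mul_mx22 (a b c e a' b' c' e' : R[i]) : mx22 a b c e *m mx22 a' b' c' e' =
  mx22 (a * a' + b * c') (a * b' + b * e') (c * a' + e * c') (c * b' + e * e').
Proof.
apply/matrixP => i j; rewrite !mxE !big_ord_recl big_ord0 !mxE /= addr0.
by case: ifP => _; case: ifP => _.
Qed.

Lemma add_mx22 (a b c e a' b' c' e' : R[i]) : mx22 a b c e + mx22 a' b' c' e' =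
  mx22 (a + a') (b + b') (c + c') (e + e').
Proof. by apply/matrixP => i j; rewrite !mxE; case: ifP => _; case: ifP. Qed.

Lemma scale_mx22 (k a b c e : R[i]) :
  k *: mx22 a b c e = mx22 (k * a) (k * b) (k * c) (k * e).
Proof. by apply/matrixP => i j; rewrite !mxE; case: ifP => _; case: ifP. Qed.

Lemma scalar_mx22 (k : R[i]) : k%:M = mx22 k 0 0 k.
Proof.
by apply/matrixP => -[[|[|//]] ?] [[|[|//]] ?]; rewrite !mxE.
Qed.

Lemma mxtrace_mx22 (a b c e : R[i]) : \tr (mx22 a b c e) = a + e.
Proof. by rewrite /mxtrace !big_ord_recl big_ord0 !mxE addr0. Qed.

Lemma mx22_eta (A : 'M[R[i]]_2) : A = mx22 (A 0 0) (A 0 1) (A 1 0) (A 1 1).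
Proof.
by apply/matrixP => -[[|[|//]] ?] [[|[|//]] ?]; rewrite !mxE /=;
  congr (A _ _); apply: val_inj.
Qed.

Lemma dot_pauli_sqr v : dot_pauli v *m dot_pauli v = ((dotv v v)%:C)%:M.
Proof.
rewrite dot_pauliE mul_mx22 scalar_mx22 dotvE.
by apply: mx22P; apply/eqP; rewrite eq_complex /=;
  apply/andP; split; apply/eqP; ring.
Qed.

Lemma dot_pauliN v : dot_pauli (- v) = - dot_pauli v.
Proof.
rewrite /dot_pauli -sumrN; apply: eq_bigr => k _.
by rewrite mxE rmorphN scaleNr.
Qed.

Lemma dot_pauli_herm v : (dot_pauli v)^t* = dot_pauli v.
Proof.
rewrite dot_pauliE; apply/matrixP => i j; rewrite !mxE.
by case: (i == 0); case: (j == 0); apply/eqP; rewrite eq_complex /=; apply/andP; split;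
  apply/eqP; rewrite /=; ring.
Qed.

(** The quadratic form of [A] at [v] is [c^-1] times the squared norm of [A *m v]. *)
Lemma psd_scale_idempotent d (c : R[i]) (A : 'M[R[i]]_d) :
  0 < c -> A^t* = A -> A *m A = c *: A -> psd A.
Proof.
move=> c0 AH AA v.
have -> : v^t* *m A *m v = c^-1 *: ((A *m v)^t* *m (A *m v)).
  rewrite trmx_mul map_mxM AH !mulmxA -(mulmxA _ A A) AA -scalemxAr -scalemxAl.
  by rewrite scalerA mulVf ?gt_eqF // scale1r.
rewrite mxE; apply: mulr_ge0; first by rewrite invr_ge0 ltW.
rewrite mxE; apply: sumr_ge0 => i _.
by rewrite !mxE mulrC mul_conjC_ge0.
Qed.

Lemma psd_1D_dot_pauli v (k : R[i]) :
  0 < k -> dotv v v = 1 -> psd (k *: (1%:M + dot_pauli v)).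
Proof.
move=> k0 v1; have kR : k^* = k by apply/CrealP/gtr0_real.
(* For a unit vector, [1 + v . sigma] squares to twice itself. *)
apply: (@psd_scale_idempotent _ (2 * k)); first by rewrite mulr_gt0.
  rewrite linearZ /= map_mxZ /= kR linearD /= map_mxD dot_pauli_herm.
  by rewrite trmx1 map_mx1.
rewrite -scalemxAl -scalemxAr !scalerA mulmxDl !mulmxDr !mul1mx !mulmx1.
rewrite dot_pauli_sqr v1 rmorph1 (addrC (dot_pauli v)) -mulr2n -scaler_nat scalerA.
by congr (_ *: _); ring.
Qed.

(** Comparing the norms of two opposite vertices shows that the center [c] is orthogonal to each
    axis, so [c = 0]; then [r ^ 2 = 1] and [0 < r] give [r = 1]. *)
Lemma octahedron_vertices (n : 'I_6 -> 'rV[R]_3) :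
  regular_octahedron n -> (forall y, in_unit_sphere (n y)) ->
  exists (Q : 'M[R]_3) (f : 'I_6 -> bool * 'I_3),
    [/\ Q *m Q^T = 1%:M, bijective f &
        forall y, n y = (-1) ^+ (f y).1 *: row (f y).2 Q].
Proof.
move=> [c [r [Q [f [r0 QQ fbij nE]]]]] n1; exists Q, f; split=> //.
have [g fK gK] := fbij.
have qq j : dotv (row j Q) (row j Q) = 1.
  have /matrixP/(_ j j) := QQ; rewrite !mxE eqxx mulr1n => <-.
  by apply: eq_bigr => k _; rewrite !mxE.
have norm (b : bool) j : dotv c c + r ^+ 2 + 2 * r * (-1) ^+ b * dotv c (row j Q) = 1.
  have -> : r ^+ 2 = r ^+ 2 * dotv (row j Q) (row j Q) by rewrite qq mulr1.
  rewrite -[RHS](n1 (g (b, j))) nE gK /dotv !mulr_sumr -!big_split /=.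
  apply: eq_bigr => k _; rewrite !mxE.
  by case: b; rewrite /= ?expr1 ?expr0; ring.
have cq j : dotv c (row j Q) = 0.
  have := norm false j; have := norm true j; rewrite expr1 expr0 => N1 N2.
  have /eqP : r * dotv c (row j Q) = 0 by lra.
  by rewrite mulf_eq0 gt_eqF //= => /eqP.
have c0 : c = 0.
  rewrite -[c]mulmx1 -(mulmx1C QQ) mulmxA.
  suff -> : c *m Q^T = 0 by rewrite mul0mx.
  apply/rowP => j; rewrite !mxE -[RHS](cq j).
  by apply: eq_bigr => k _; rewrite !mxE.
have r1 : r = 1.
  have := norm false ord0; rewrite cq mulr0 addr0 c0 /dotv big1 => [|k _]; last first.
    by rewrite mxE mul0r.
  by rewrite add0r => rr; nra.
by move=> y; rewrite nE c0 r1 add0r scale1r.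
Qed.

End Octahedron.

(** * Moments of the vertices of the octahedron *)

Section Vertices.
Variables (R : realType) (n : 'I_6 -> 'rV[R]_3) (Q : 'M[R]_3).
Variable f : 'I_6 -> bool * 'I_3.
Hypothesis QQ : Q *m Q^T = 1%:M.
Hypothesis fbij : bijective f.
Hypothesis nE : forall y, n y = (-1) ^+ (f y).1 *: row (f y).2 Q.

Lemma dotv_rows i j : dotv (row i Q) (row j Q) = (i == j)%:R.
Proof.
have /matrixP/(_ i j) := QQ; rewrite !mxE => <-.
by apply: eq_bigr => k _; rewrite !mxE.
Qed.

Lemma sum_vertices (V : nmodType) (F : 'rV[R]_3 -> V) :
  \sum_y F (n y) = \sum_j (F (row j Q) + F (- row j Q)).
Proof.
have [g fK gK] := fbij; rewrite (reindex_onto g f) /=; last by move=> y _; rewrite fK.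
rewrite (eq_bigl (fun=> true)); last by move=> x; rewrite gK eqxx.
rewrite (eq_bigr (fun x : bool * 'I_3 => F ((-1) ^+ x.1 *: row x.2 Q)));
  last by move=> x _; rewrite nE gK.
rewrite -(pair_big xpredT xpredT (fun (b : bool) j => F ((-1) ^+ b *: row j Q))) /=.
rewrite exchange_big; apply: eq_bigr => j _.
by rewrite big_bool expr0 expr1 scale1r scaleN1r addrC.
Qed.

Local Notation cv v := (map_mx (real_complex R) v).

Lemma sum_dotv_map_rows (u v : 'rV[R[i]]_3) :
  \sum_j dotv (cv (row j Q)) u * dotv (cv (row j Q)) v = dotv u v.
Proof.
under eq_bigr do rewrite map_row.
by apply: sum_dotv_rows; rewrite map_trmx -map_mxM QQ map_mx1.
Qed.

(* The octahedron is a spherical 3-design: sums of cubic polynomials over it only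
   see the second moment. *)
Lemma sum_vertices_affine3 (c1 c2 c3 : R[i]) (u1 u2 u3 : 'rV[R[i]]_3) :
  \sum_y (c1 + dotv (cv (n y)) u1) * (c2 + dotv (cv (n y)) u2)
         * (c3 + dotv (cv (n y)) u3)
  = 6 * (c1 * c2 * c3)
    + 2 * (c1 * dotv u2 u3 + c2 * dotv u1 u3 + c3 * dotv u1 u2).
Proof.
rewrite (sum_vertices (fun v => (c1 + dotv (cv v) u1) * (c2 + dotv (cv v) u2)
         * (c3 + dotv (cv v) u3))).
transitivity (\sum_(j < 3) (2 * (c1 * c2 * c3) + 2 * (
   c1 * (dotv (cv (row j Q)) u2 * dotv (cv (row j Q)) u3)
   + c2 * (dotv (cv (row j Q)) u1 * dotv (cv (row j Q)) u3)
   + c3 * (dotv (cv (row j Q)) u1 * dotv (cv (row j Q)) u2)))).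
  (* Adding the values at [v] and [- v] cancels the terms of odd degree, among them the cubic
     one. *)
  by apply: eq_bigr => j _; rewrite !map_mxN !dotvNl; ring.
rewrite big_split /= sumr_const card_ord -mulr_sumr !big_split /= -!mulr_sumr.
by rewrite !sum_dotv_map_rows; congr (_ + _); ring.
Qed.

End Vertices.

Section Design.
Variable R : realType.

(** With this vector each entry of [dot_pauli v] is a linear form in [v], as [sum_vertices_affine3]
    requires. *)
Definition pauli_entry (a b : 'I_2) : 'rV[R[i]]_3 := \row_k pauli R k a b.

Lemma dot_pauli_entry (v : 'rV[R]_3) a b :
  dot_pauli v a b = dotv (map_mx (real_complex R) v) (pauli_entry a b).
Proof. by rewrite summxE; apply: eq_bigr => k _; rewrite !mxE. Qed.

Lemma pauli_completeness (a b c e : 'I_2) :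
  dotv (pauli_entry a b) (pauli_entry c e)
  = 2 * ((a == e) && (b == c))%:R - ((a == b) && (c == e))%:R.
Proof.
have i2 : 'i%C * 'i%C = -1 :> R[i] by rewrite -expr2 sqr_i.
rewrite /dotv !big_ord_recl big_ord0 !mxE.
by case: a b c e => -[|[|//]] ? [[|[|//]] ?] [[|[|//]] ?] [[|[|//]] ?] /=;
  rewrite ?mulrNN ?mulrN ?mulNr ?i2; ring.
Qed.

End Design.

(** * The octahedral POVM is a 3-design *)

(** A version of [digit_word] on plain naturals, so that orbits can be compared and counted by
    evaluation. *)
Definition digits (d k a : nat) : seq nat :=
  [seq (a %/ d ^ (k - l.+1)) %% d | l <- iota 0 k]%N.

Lemma digit_wordE (d k : nat) (a : 'I_(d ^ k)) : digit_word a = digits d k a :> seq nat.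
Proof. by rewrite /digits -val_enum_ord -map_comp; apply: eq_map. Qed.

Lemma same_typeE (d k : nat) (a b : 'I_(d ^ k)) :
  same_type a b = perm_eq (digits d k a) (digits d k b).
Proof. by rewrite /same_type !digit_wordE. Qed.

Lemma type_cardE (d k : nat) (a : 'I_(d ^ k)) :
  type_card a = count (fun b => perm_eq (digits d k a) (digits d k b)) (iota 0 (d ^ k)).
Proof.
rewrite /type_card -val_enum_ord count_map cardE enumT /enum_mem size_filter.
by apply: eq_count => b; rewrite /= unfold_in -same_typeE.
Qed.

(** Matrix entry of the operator exchanging two tensor factors. *)
Definition swap2 (a1 a2 b1 b2 : nat) : bool := (a1 == b2) && (b1 == a2).

(* By Pauli completeness, 4 * count2 and 4 * count3 are the entries of the second
   and third tensor powers of 1 + n_y . sigma, summed over the octahedron. *)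
Definition count2 (a b : nat) : nat :=
  let a1 := (a %/ 2)%N in let b1 := (b %/ 2)%N in
  let a2 := (a %% 2)%N in let b2 := (b %% 2)%N in
  (((a1 == b1) && (a2 == b2)) + swap2 a1 a2 b1 b2)%N.

Definition count3 (a b : nat) : nat :=
  let a1 := (a %/ 4)%N in let b1 := (b %/ 4)%N in
  let a2 := (a %% 4 %/ 2)%N in let b2 := (b %% 4 %/ 2)%N in
  let a3 := (a %% 4 %% 2)%N in let b3 := (b %% 4 %% 2)%N in
  ((a1 == b1) * swap2 a2 a3 b2 b3 + (a2 == b2) * swap2 a1 a3 b1 b3
   + (a3 == b3) * swap2 a1 a2 b1 b2)%N.

Lemma ord_checkP m (P : nat -> nat -> bool) :
  all (fun a => all (P a) (iota 0 m)) (iota 0 m) ->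
  forall a b : 'I_m, P a b.
Proof.
move=> /allP H a b; have ord_iota (c : 'I_m) : val c \in iota 0 m.
  by rewrite mem_iota /= ltn_ord.
exact: (allP (H _ (ord_iota a)) _ (ord_iota b)).
Qed.

Lemma type_card_count1 (a b : 'I_(2 ^ 1)) :
  (same_type a b = (a == b) * type_card a :> nat)%N.
Proof.
apply/eqP; rewrite same_typeE type_cardE -val_eqE; move: a b.
by apply: (@ord_checkP _ (fun a b => _ (perm_eq (digits 2 1 a) (digits 2 1 b)) ==
  ((a == b) * count (fun b => perm_eq (digits 2 1 a) (digits 2 1 b)) (iota 0 (2 ^ 1)))%N)).
Qed.

Lemma type_card_count2 (a b : 'I_(2 ^ 2)) :
  (2 * same_type a b = count2 a b * type_card a)%N.
Proof.
apply/eqP; rewrite same_typeE type_cardE; move: a b.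
by apply: (@ord_checkP _ (fun a b => 2 * (perm_eq (digits 2 2 a) (digits 2 2 b)) ==
  (count2 a b * count (fun b => perm_eq (digits 2 2 a) (digits 2 2 b)) (iota 0 (2 ^ 2)))%N)%N).
Qed.

(** There is no nonzero alternating tensor in the third power of a two-dimensional space, so even
    and odd permutations of the factors have equal sums there. Hence three times the symmetric
    projector is the sum of the three transpositions, whose entries are [count3]. *)
Lemma type_card_count3 (a b : 'I_(2 ^ 3)) :
  (3 * same_type a b = count3 a b * type_card a)%N.
Proof.
apply/eqP; rewrite same_typeE type_cardE; move: a b.
by apply: (@ord_checkP _ (fun a b => 3 * (perm_eq (digits 2 3 a) (digits 2 3 b)) ==
  (count3 a b * count (fun b => perm_eq (digits 2 3 a) (digits 2 3 b)) (iota 0 (2 ^ 3)))%N)%N).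
Qed.

Lemma type_averageE (R : realType) (d k s c : nat) (a b : 'I_(d ^ k)) :
  (s * same_type a b = c * type_card a)%N ->
  c%:R = s%:R * type_average_mx R d k a b.
Proof.
move=> sc; have t0 : (type_card a)%:R != 0 :> R[i].
  by rewrite pnatr_eq0 -lt0n type_card_gt0.
by rewrite mxE mulrA -natrM sc natrM mulfK.
Qed.

Section OctahedralDesign.
Variables (R : realType) (n : 'I_6 -> 'rV[R]_3) (Q : 'M[R]_3).
Variable f : 'I_6 -> bool * 'I_3.
Hypothesis QQ : Q *m Q^T = 1%:M.
Hypothesis fbij : bijective f.
Hypothesis nE : forall y, n y = (-1) ^+ (f y).1 *: row (f y).2 Q.

Let M y : 'M[R[i]]_2 := 1%:M + dot_pauli (n y).

(** In the cubic moment formula, the constant term [6] cancels against the [- 2] that each of the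
    three completeness relations contributes; only the swaps remain. *)
Lemma sum_entries3 (a1 a2 a3 b1 b2 b3 : 'I_2) :
  \sum_y M y a1 b1 * M y a2 b2 * M y a3 b3
  = 4 * ((a1 == b1) * swap2 a2 a3 b2 b3 + (a2 == b2) * swap2 a1 a3 b1 b3
         + (a3 == b3) * swap2 a1 a2 b1 b2)%:R.
Proof.
under eq_bigr do rewrite /M !(mxE _ _ a1 b1) !(mxE _ _ a2 b2)
    !(mxE _ _ a3 b3) !dot_pauli_entry.
rewrite (sum_vertices_affine3 QQ fbij nE) !pauli_completeness.
rewrite !natrD !natrM /swap2 !val_eqE -!mulnb !natrM.
by ring.
Qed.

Lemma sum_entries2 (a1 a2 b1 b2 : 'I_2) :
  \sum_y M y a1 b1 * M y a2 b2
  = 4 * (((a1 == b1) && (a2 == b2)) + swap2 a1 a2 b1 b2)%:R.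
Proof.
have d0 (u : 'rV[R[i]]_3) : dotv u 0 = 0.
  by rewrite /dotv big1 // => k _; rewrite mxE mulr0.
(* A third factor equal to [1], with zero linear part, brings the sum to the cubic form. *)
transitivity (\sum_y M y a1 b1 * M y a2 b2 *
    (1 + dotv (map_mx (real_complex R) (n y)) 0)).
  by apply: eq_bigr => y _; rewrite d0 addr0 mulr1.
under eq_bigr do rewrite /M !(mxE _ _ a1 b1) !(mxE _ _ a2 b2)
    !dot_pauli_entry.
rewrite (sum_vertices_affine3 QQ fbij nE) !d0 pauli_completeness.
rewrite !natrD /swap2 !val_eqE -!mulnb !natrM.
by ring.
Qed.

Lemma sum_polyhedral_povm : \sum_y polyhedral_povm n y = 1%:M.
Proof.
rewrite /polyhedral_povm -scaler_sumr big_split /=.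
rewrite (sum_vertices fbij nE (fun v => dot_pauli v)) [X in _ + X]big1 ?addr0 => [|j _].
  by rewrite sumr_const card_ord -[1%:M *+ _]scaler_nat scalerA mulVf ?scale1r // pnatr_eq0.
by rewrite dot_pauliN subrr.
Qed.

Lemma mxtrace_polyhedral_povm y : \tr (polyhedral_povm n y) = 3^-1.
Proof.
rewrite /polyhedral_povm mxtraceZ dot_pauliE scalar_mx22 add_mx22 mxtrace_mx22.
by rewrite rmorphN; field.
Qed.

Lemma octahedral_povm_design : (forall y, dotv (n y) (n y) = 1) ->
  is_design_povm 3 (polyhedral_povm n).
Proof.
move=> n1; split; first split.
- by move=> y; apply: psd_1D_dot_pauli; rewrite ?invr_gt0 ?ltr0n.
- exact: sum_polyhedral_povm.
case=> [|[|[|[|k]]]] // _; rewrite sym_projectorE; apply/matrixP => a b.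
- rewrite summxE; transitivity ((1%:M : 'M[R[i]]_2) a b).
    rewrite -sum_polyhedral_povm summxE; apply: eq_bigr => y _.
    by rewrite expr0 invr1 scale1r ntensmx1.
  transitivity (1%:R * type_average_mx R 2 1 a b).
    rewrite [LHS]mxE; apply: type_averageE.
    by rewrite mul1n type_card_count1.
  by rewrite [RHS]mxE; congr (_ * _); rewrite (_ : 'C(1 + 1, 1) = 2)%N //; field.
- rewrite summxE; transitivity (3^-1 * (count2 a b)%:R : R[i]).
    (* The [3] is the inverse of the trace and [36] collects a [6^-1] from each factor; with the [4]
       of [sum_entries2] this makes [3^-1]. *)
    transitivity (3 / 36 * \sum_y M y (mxtens_unindex (m := 2) (n := 2) a).1
         (mxtens_unindex (m := 2) (n := 2) b).1
         * M y (mxtens_unindex (m := 2) (n := 2) a).2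
         (mxtens_unindex (m := 2) (n := 2) b).2).
      rewrite mulr_sumr; apply: eq_bigr => y _.
      rewrite mxE mxtrace_polyhedral_povm ntensmx2 mxE /polyhedral_povm
        !(mxE _ _ (mxtens_unindex _).1) !(mxE _ _ (mxtens_unindex _).2).
      by field.
    by rewrite sum_entries2 mulrA; congr (_ * _); field.
  rewrite [RHS]mxE (type_averageE R (type_card_count2 a b)) mulrA; congr (_ * _).
  by rewrite (_ : 'C(1 + 2, 2) = 3)%N //; field.
- rewrite summxE; transitivity (6^-1 * (count3 a b)%:R : R[i]).
    pose u (a : 'I_(2 ^ 3)) := mxtens_unindex (m := 2) (n := 4) a.
    pose u2 (a : 'I_(2 ^ 3)) := mxtens_unindex (m := 2) (n := 2) (u a).2.
    (* The trace now enters with exponent [-2], and [4 * 9 / 216 = 6^-1]. *)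
    transitivity (9 / 216 * \sum_y M y (u a).1 (u b).1 * M y (u2 a).1 (u2 b).1
       * M y (u2 a).2 (u2 b).2).
      rewrite mulr_sumr; apply: eq_bigr => y _.
      rewrite mxE mxtrace_polyhedral_povm 2!ntensmxSS ntensmx1 mxE
        [X in _ * (_ * X)]mxE /polyhedral_povm !(mxE _ _ (u _).1) !(mxE _ _ (u2 _).2)
        !(mxE _ _ (u2 _).1).
      by field.
    by rewrite sum_entries3 mulrA; congr (_ * _); field.
  rewrite [RHS]mxE (type_averageE R (type_card_count3 a b)) mulrA; congr (_ * _).
  by rewrite (_ : 'C(1 + 3, 3) = 4)%N //; field.
Qed.

End OctahedralDesign.

(** * The informational power *)

Section Bloch.
Variable R : realType.

Lemma psd_mx22 (A : 'M[R[i]]_2) : psd A -> exists a e b1 b2 : R,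
  [/\ A = mx22 a%:C (b1 +i* b2) (b1 -i* b2) e%:C, 0 <= a, 0 <= e
    & b1 ^+ 2 + b2 ^+ 2 <= a * e].
Proof.
move=> A0; have form x y : 0 <= x^* * (A 0 0 * x + A 0 1 * y)
                             + y^* * (A 1 0 * x + A 1 1 * y).
  have := A0 (\col_i (if i == 0 then x else y)); rewrite -mulmxA.
  have -> : A *m (\col_i (if i == 0 then x else y))
    = \col_i (if i == 0 then A 0 0 * x + A 0 1 * y else A 1 0 * x + A 1 1 * y).
    rewrite [A in LHS]mx22_eta; apply/colP => i.
    by rewrite !mxE !big_ord_recl big_ord0 !mxE /= addr0; case: ifP.
  by rewrite mxE !big_ord_recl big_ord0 !mxE /= addr0.
rewrite (mx22_eta A); move: form.
case: (A 0 0) (A 0 1) (A 1 0) (A 1 1) => [a a'] [b1 b2] [c1 c2] [e e'] form.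
have real x1 x2 y1 y2 := form (x1 +i* x2) (y1 +i* y2).
have {form}real x1 x2 y1 y2 := real x1 x2 y1 y2.
move: real; rewrite /= => real.
(* The vectors [(1, 0)] and [(0, 1)] give a real nonnegative diagonal; [(1, 1)] and [(1, i)] then
   make the off-diagonal entries conjugate. *)
have h1 := real 1 0 0 0; have h2 := real 0 0 1 0.
have h3 := real 1 0 1 0; have h4 := real 1 0 0 1.
rewrite lecE in h1; rewrite lecE in h2; rewrite lecE in h3; rewrite lecE in h4.
move: h1 h2 h3 h4 => /= /andP[/eqP h1 a0] /andP[/eqP h2 e0] /andP[/eqP h3 _]
  /andP[/eqP h4 _].
have a'0 : a' = 0 by lra.
have e'0 : e' = 0 by lra.
have c2E : c2 = - b2 by lra.
have c1E : c1 = b1 by lra.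
have {}a0 : 0 <= a by lra.
have {}e0 : 0 <= e by lra.
exists a, e, b1, b2; split=> //; first by rewrite a'0 e'0 c1E c2E.
have h1' := real e 0 (- b1) b2; have h2' := real b1 b2 (- a) 0.
have h3' := real 1 0 (- b1) b2.
rewrite lecE a'0 e'0 c1E c2E /= in h1'; rewrite lecE a'0 e'0 c1E c2E /= in h2'.
rewrite lecE a'0 e'0 c1E c2E /= in h3'.
move: h1' h2' h3' => /andP[_ H1] /andP[_ H2] /andP[_ H3].
have [epos|ele] := ltP 0 e.
  have : 0 <= e * (a * e - (b1 ^+ 2 + b2 ^+ 2)) by nra.
  by rewrite pmulr_rge0 // subr_ge0.
have [apos|ale] := ltP 0 a.
  have : 0 <= a * (a * e - (b1 ^+ 2 + b2 ^+ 2)) by nra.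
  by rewrite pmulr_rge0 // subr_ge0.
have ez : e = 0 by lra.
have az : a = 0 by lra.
by rewrite ez az in H3 *; lra.
Qed.

(* Positivity of A is |m| <= tr A for its Bloch vector m. *)
Lemma psd_bloch (A : 'M[R[i]]_2) : psd A ->
  exists m : 'rV[R]_3,
    [/\ 0 <= complex.Re (\tr A), dotv m m <= complex.Re (\tr A) ^+ 2
      & forall (k : R) v, joint_prob A (k%:C *: (1%:M + dot_pauli v))
          = k * (complex.Re (\tr A) + dotv v m)].
Proof.
move=> /psd_mx22[a [e [b1 [b2 [-> a0 e0 b0]]]]].
(* The coordinates are the traces of [A *m pauli R k], so [A] is half of [tr A + m . sigma]. *)
exists (\row_k (if k == 0 then 2 * b1 else if k == 1 then - 2 * b2 else a - e)).
rewrite mxtrace_mx22 /=; split; first by lra.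
  by rewrite dotvE !mxE /=; nra.
move=> k v; rewrite /joint_prob scalar_mx22 dot_pauliE add_mx22 scale_mx22 mul_mx22.
by rewrite mxtrace_mx22 dotvE !mxE /=; ring.
Qed.
End Bloch.

(** * The octahedral POVM and the anti-octahedral ensemble *)

Section OctahedralPovm.
Variables (R : realType) (n : 'I_6 -> 'rV[R]_3) (Q : 'M[R]_3).
Variable f : 'I_6 -> bool * 'I_3.
Hypothesis QQ : Q *m Q^T = 1%:M.
Hypothesis fbij : bijective f.
Hypothesis nE : forall y, n y = (-1) ^+ (f y).1 *: row (f y).2 Q.
Local Notation pi := (polyhedral_povm n).
Local Notation psi := (anti_ensemble n).

Lemma polyhedral_povmE y : pi y = (6^-1)%:C *: (1%:M + dot_pauli (n y)).
Proof. by rewrite /polyhedral_povm fmorphV rmorph_nat. Qed.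

(** The square is one of the nonnegative terms of Parseval's sum for [dotv m m]. *)
Lemma dotv_row_sqr_le m (t : R) j :
  0 <= t -> dotv m m <= t ^+ 2 -> `|dotv (row j Q) m| <= t.
Proof.
move=> t0 mt; rewrite -(ger0_norm t0) -ler_sqr ?nnegrE ?normr_ge0 //.
rewrite !real_normK ?num_real //; apply: le_trans mt.
rewrite -(sum_dotv_rows m m QQ) (bigD1 j) //= expr2 lerDl.
by apply: sumr_ge0 => i _; rewrite -expr2 sqr_ge0.
Qed.

Lemma octahedral_joint_prob_ge0 A y : psd A -> 0 <= joint_prob A (pi y).
Proof.
move=> /psd_bloch[m [t0 mt AE]]; rewrite polyhedral_povmE AE.
apply: mulr_ge0; first by rewrite invr_ge0 ler0n.
have := dotv_row_sqr_le (f y).2 t0 mt; rewrite ler_norml nE => /andP[].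
case: (f y).1; rewrite ?expr1 ?expr0 ?scaleN1r ?scale1r ?dotvNl; lra.
Qed.

Lemma ln4 : ln (4 : R) = 2 * ln 2.
Proof. by rewrite (_ : 4 = 2 * 2) ?lnM ?posrE //; ring. Qed.

Lemma octahedral_relative_entropy_le A : psd A ->
  \sum_y joint_prob A (pi y) *
    ln (6%:R * joint_prob A (pi y) / complex.Re (\tr A))
  <= 6^-1 * ln 4 * complex.Re (\tr A).
Proof.
move=> /psd_bloch[m [t0 mt AE]]; set t := complex.Re _ in t0 mt AE *.
under eq_bigr do rewrite polyhedral_povmE AE.
rewrite (sum_vertices fbij nE (fun v => 6^-1 * (t + dotv v m)
  * ln (6%:R * (6^-1 * (t + dotv v m)) / t))).
move: t0; rewrite le_eqVlt => /predU1P[tz|tpos].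
  (* At trace zero the Bloch vector is orthogonal to every axis and all terms vanish. *)
  rewrite -tz in mt *; rewrite mulr0 big1 // => j _.
  have := dotv_row_sqr_le j (lexx 0) mt; rewrite normr_le0 => /eqP.
  by rewrite dotvNl => ->; rewrite oppr0 addr0 mulr0 !mul0r addr0.
have tn0 : t != 0 by rewrite gt_eqF.
rewrite (eq_bigr (fun j => t / 6 * pair_entropy (dotv (row j Q) m / t))); last first.
  move=> j _; rewrite dotvNl /pair_entropy.
  set s := dotv _ _.
  have -> : 6%:R * (6^-1 * (t + s)) / t = 1 + s / t by field.
  have -> : 6%:R * (6^-1 * (t - s)) / t = 1 - s / t by field.
  by field.
rewrite -mulr_sumr.
have : \sum_j pair_entropy (dotv (row j Q) m / t) <=
    \sum_j (2 * ln 2 * (dotv (row j Q) m / t) ^+ 2).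
  apply: ler_sum => j _; apply: pair_entropy_le.
  have := dotv_row_sqr_le j (ltW tpos) mt; rewrite ler_norml => /andP[l1 l2].
  by rewrite ler_pdivlMr // ler_pdivrMr // mulN1r mul1r l1.
have -> : \sum_j 2 * ln 2 * (dotv (row j Q) m / t) ^+ 2 = 2 * ln 2 * (t ^- 2 * dotv m m).
  rewrite -(sum_dotv_rows m m QQ) !mulr_sumr; apply: eq_bigr => j _.
  by field.
move=> H.
have ln2 : 0 <= ln (2 : R) by apply: ln_ge0; lra.
have mt1 : t ^- 2 * dotv m m <= 1 by rewrite mulrC ler_pdivrMr ?exprn_gt0 // mul1r.
rewrite ln4 (_ : 6^-1 * (2 * ln 2) * t = t / 6 * (2 * ln 2)); last by ring.
apply: ler_wpM2l; first by rewrite divr_ge0 // ltW.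
by apply: le_trans H _; rewrite -[leRHS]mulr1 ler_wpM2l // mulr_ge0.
Qed.

Lemma octahedral_informational_power_le :
  (informational_power pi <= (6^-1 * ln 4)%:E)%E.
Proof.
have piS := sum_polyhedral_povm fbij nE.
apply: ge_ereal_sup => _ [[rho rhoP ->]|[m [rho [rhoP ->]]]].
  apply: mutual_info_le => //.
  - by move=> A y; exact: octahedral_joint_prob_ge0.
  - exact: octahedral_relative_entropy_le.
rewrite lee_fin; apply: fin_mutual_info_le => //.
- by move=> A y; exact: octahedral_joint_prob_ge0.
- exact: octahedral_relative_entropy_le.
Qed.

Hypothesis n1 : forall y, dotv (n y) (n y) = 1.

Lemma anti_ensembleE x : psi x = (12^-1)%:C *: (1%:M - dot_pauli (n x)).
Proof. by rewrite /anti_ensemble fmorphV rmorph_nat. Qed.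

Lemma anti_ensemble_fin : is_fin_ensemble psi.
Proof.
split.
  move=> x; rewrite /anti_ensemble -dot_pauliN; apply: psd_1D_dot_pauli.
    by rewrite invr_gt0 ltr0n.
  by rewrite dotvNl dotvC dotvNl opprK.
rewrite (eq_bigr (fun=> 6^-1)) => [|x _].
  by rewrite sumr_const card_ord -[_ *+ 6]mulr_natl mulfV // pnatr_eq0.
rewrite /anti_ensemble mxtraceZ -dot_pauliN dot_pauliE scalar_mx22 add_mx22 mxtrace_mx22.
by rewrite rmorphN; field.
Qed.

Lemma anti_ensemble_joint_prob x y :
  joint_prob (psi x) (pi y) = 36^-1 * (1 - dotv (n x) (n y)).
Proof.
rewrite polyhedral_povmE anti_ensembleE /joint_prob -dot_pauliN !dot_pauliE scalar_mx22.
rewrite !add_mx22 !scale_mx22 mul_mx22 mxtrace_mx22 dotvE !mxE /=.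
by field.
Qed.

(** Both marginals are uniform. For each [x] the outcome at [n x] has probability [0], the four
    orthogonal ones contribute [ln 1 = 0], and the opposite one contributes [2 * ln 2 / 36]; there
    are six such [x]. *)
Lemma anti_ensemble_mutual_info : fin_mutual_info psi pi = 6^-1 * ln 4.
Proof.
pose p u v : R := 36^-1 * (1 - dotv u v).
have tot v : \sum_y p v (n y) = 6^-1.
  rewrite (sum_vertices fbij nE (p v)) (eq_bigr (fun=> 18^-1)).
    by rewrite sumr_const card_ord -[_ *+ 3]mulr_natl; field.
  by move=> j _; rewrite /p ![dotv v _]dotvC dotvNl; field.
have pC u v : p u v = p v u by rewrite /p dotvC.
rewrite /fin_mutual_info.
under eq_bigr => x _.
  under eq_bigr => y _.
    rewrite anti_ensemble_joint_prob.
    under [X in mi_term _ X _]eq_bigr do rewrite anti_ensemble_joint_prob.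
    under [X in mi_term _ _ X]eq_bigr do rewrite anti_ensemble_joint_prob -/(p _ _) pC.
    rewrite -/(p _ _) !tot; over.
  over.
have mi u : mi_term (36^-1 * (1 - u)) 6^-1 6^-1 = 36^-1 * (1 - u) * ln (1 - u) :> R.
  by rewrite /mi_term; congr (_ * ln _); field.
rewrite (sum_vertices fbij nE (fun u => \sum_y mi_term (p u (n y)) 6^-1 6^-1)).
rewrite (eq_bigr (fun=> 18^-1 * ln 4)).
  by rewrite sumr_const card_ord -[_ *+ 3]mulr_natl; field.
move=> j _; rewrite !(sum_vertices fbij nE (fun v => mi_term (p _ v) _ _)).
rewrite -big_split (bigD1 j) //= big1 => [|i ij].
  rewrite /p !mi !dotvNl ![dotv (row j Q) (- _)]dotvC !dotvNl (dotv_rows QQ) eqxx.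
  by rewrite subrr !opprK mulr1n ln4; field.
rewrite /p !mi !dotvNl ![dotv (row j Q) (- _)]dotvC !dotvNl !(dotv_rows QQ).
have ji : (j == i) = false by rewrite eq_sym (negPf ij).
by rewrite ji (negPf ij) !mulr0n !oppr0 !addr0 ln1 !mulr0 !addr0.
Qed.

(** For a unit vector, [(1 - n . sigma) (1 + n . sigma) = 1 - (n . sigma) ^ 2 = 0]. *)
Lemma anti_ensemble_mul x : psi x *m pi x = 0.
Proof.
rewrite anti_ensembleE polyhedral_povmE -scalemxAl -scalemxAr
  mulmxBl !mulmxDr !mul1mx mulmx1.
by rewrite dot_pauli_sqr n1 rmorph1 [dot_pauli _ + _]addrC subrr !scaler0.
Qed.
End OctahedralPovm.

Theorem corollary8 (R : realType) (n : 'I_6 -> 'rV[R]_3)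
    (hn : regular_octahedron n) (hs : forall y, in_unit_sphere (n y)) :
  let pi := polyhedral_povm n in
  let psi := anti_ensemble n in
  [/\ is_design_povm 3 pi,
      informational_power pi = (6^-1 * ln 4)%:E,
      is_fin_ensemble psi,
      (fin_mutual_info psi pi)%:E = informational_power pi
    & forall x, psi x *m pi x = 0].
Proof.
move=> pi psi; have [Q [f [QQ fbij nE]]] := octahedron_vertices hn hs.
have n1 y : dotv (n y) (n y) = 1 by rewrite -[RHS](hs y); apply: eq_bigr.
have psi_fin := anti_ensemble_fin n1.
have mi_psi := anti_ensemble_mutual_info QQ fbij nE.
have W : informational_power pi = (6^-1 * ln 4)%:E.
  apply/eqP; rewrite eq_le (octahedral_informational_power_le QQ fbij nE) /=.
  rewrite -mi_psi; apply: ereal_sup_ubound; right.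
  by exists 6%N, psi.
split=> //.
- exact: octahedral_povm_design QQ fbij nE n1.
- by rewrite W mi_psi.
- exact: anti_ensemble_mul.
Qed.
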